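(* Let $D\in\mathbb{N}$, let $\{\xi_1,\xi_2,\ldots,\xi_D\}$ be independent nonnegative random variables with distribution functions $\{F_{\xi_1},F_{\xi_2},\ldots,F_{\xi_D}\}$, and let $\eta$ be a counting random variable independent of $\{\xi_1,\xi_2,\ldots,\xi_D\}$. Let $S_\eta=\sum_{k=1}^{\eta}\xi_k$ be the random sum. Suppose that the following three conditions hold: (1) $\mathbb{P}(\eta\leqslant D)=1$; (2) for some $\kappa\in\operatorname{supp}(\eta)\setminus\{0\}$, $F_{\xi_\kappa}\in\mathcal{OL}$; (3) with this $\kappa$, for each $k\in\{1,2,\ldots,D\}$, either $\lim_{x\to\infty}\frac{\overline{F}_{\xi_k}(x)}{\overline{F}_{\xi_\kappa}(x)}=0$ or $F_{\xi_k}\in\mathcal{OL}$. Then the distribution function $F_{S_\eta}$ of $S_\eta$ belongs to $\mathcal{OL}$.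
   Context: For a random variable $X$, $F_X(x)=\mathbb{P}(X\leqslant x)$ is its distribution function; for a distribution function $F$, $\overline{F}(x)=1-F(x)$, $x\in\mathbb{R}$, is its tail. A distribution function $F$ belongs to the class $\mathcal{OL}$ of $\mathcal{O}$-exponential distributions if for all $a\in\mathbb{R}$ $$0<\liminf_{x\to\infty}\frac{\overline{F}(x+a)}{\overline{F}(x)}\leqslant\limsup_{x\to\infty}\frac{\overline{F}(x+a)}{\overline{F}(x)}<\infty$$ (in particular, $\overline{F}(x)>0$ for all $x\in\mathbb{R}$). A counting random variable is an integer-valued, nonnegative random variable that is nondegenerate at zero (i.e. not almost surely equal to $0$). $\operatorname{supp}(\eta)=\{n\in\{0,1,2,\ldots\}:\mathbb{P}(\eta=n)>0\}$, so $\operatorname{supp}(\eta)\setminus\{0\}=\{n\in\mathbb{N}:\mathbb{P}(\eta=n)>0\}$ with $\mathbb{N}=\{1,2,\ldots\}$. Partial sums: $S_0=0$, $S_n=\xi_1+\cdots+\xi_n$ for $1\leqslant n\leqslant D$; since $\eta\leqslant D$ almost surely, $S_\eta=\sum_{k=1}^{\eta}\xi_k$ is well defined almost surely, with distribution function $F_{S_\eta}(x)=\sum_{n=0}^{D}\mathbb{P}(\eta=n)\mathbb{P}(S_n\leqslant x)$. *)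

(* Defs.v *)
From HB Require Import structures.
From mathcomp Require Import all_boot all_order all_algebra.
From mathcomp Require Import all_classical all_reals all_analysis.

Set Implicit Arguments.
Unset Strict Implicit.
Unset Printing Implicit Defensive.

Import Order.TTheory GRing.Theory Num.Theory.
Import numFieldNormedType.Exports.

Local Open Scope classical_set_scope.
Local Open Scope ring_scope.

(* The library's [cdf] takes its values in the extended reals. *)
Definition distr_fun d (T : measurableType d) (R : realType)
    (P : probability T R) (X : {RV P >-> R}) (x : R) : R :=
  fine (cdf X x).

Definition tail (R : realType) (F : R -> R) (x : R) : R := 1 - F x.

(* The positivity clause guarantees that the quotients are genuine ones.  For a
   distribution function it already follows from the liminf clause, because the
   tail is nonincreasing and division by zero yields zero. *)
Definition O_exponential (R : realType) (F : R -> R) : Prop :=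
  (forall x, 0 < tail F x) /\
  forall a : R,
    let q := fun x : R => (tail F (x + a) / tail F x)%:E in
    [/\ (0 < limf_einf q +oo%R)%E,
        (limf_einf q +oo%R <= limf_esup q +oo%R)%E
      & (limf_esup q +oo%R < +oo)%E].

Definition mutually_independent d (T : measurableType d) (R : realType)
    (P : probability T R) (I : finType) (X : I -> {RV P >-> R}) : Prop :=
  forall (J : {set I}) (A : I -> set R),
    (forall i, i \in J -> measurable (A i)) ->
    P (\bigcap_(i in [set` J]) (X i @^-1` A i)) =
    (\prod_(i in J) P (X i @^-1` A i))%E.

(* Independence of [eta] from the whole collection [X]: the second event ranges
   over the sigma-algebra generated jointly by all the [X i]. *)
Definition independent_of_family d (T : measurableType d) (R : realType)
    (P : probability T R) (eta : {RV P >-> nat})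
    (n : nat) (X : 'I_n -> {RV P >-> R}) : Prop :=
  forall (A : set nat) (B : set T),
    g_sigma_preimage (fun i => X i : T -> R) B ->
    P (eta @^-1` A `&` B) = (P (eta @^-1` A) * P B)%E.

(* Integrality and nonnegativity are built into the codomain [nat], which
   carries the discrete sigma-algebra. *)
Definition counting_rv d (T : measurableType d) (R : realType)
    (P : probability T R) (eta : {RV P >-> nat}) : Prop :=
  ~ {ae P, forall w, eta w = 0%N}.

Definition supp d (T : measurableType d) (R : realType)
    (P : probability T R) (eta : {RV P >-> nat}) : set nat :=
  [set n | (0 < P (eta @^-1` [set n]))%E].

(* Indices are shifted by one: [xi i] stands for xi_{i+1}, so that the sum of
   the first [n] variables ranges over [i < n].  For [n > D] the value is the
   sum of all [D] variables. *)
Definition partial_sum d (T : measurableType d) (R : realType)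
    (P : probability T R) (D : nat) (xi : 'I_D -> {RV P >-> R})
    (n : nat) (w : T) : R :=
  \sum_(i < D | (i < n)%N) xi i w.

Definition random_sum d (T : measurableType d) (R : realType)
    (P : probability T R) (D : nat) (xi : 'I_D -> {RV P >-> R})
    (eta : {RV P >-> nat}) (w : T) : R :=
  partial_sum xi (eta w) w.

Lemma measurable_random_sum d (T : measurableType d) (R : realType)
    (P : probability T R) (D : nat) (xi : 'I_D -> {RV P >-> R})
    (eta : {RV P >-> nat}) : measurable_fun [set: T] (random_sum xi eta).
Proof.
rewrite (_ : random_sum xi eta =
    fun w => \sum_(i < D) (if (i < eta w)%N then xi i w else 0)); last first.
  by apply/funext => w; rewrite /random_sum /partial_sum big_mkcond.
apply: measurable_sum => i; apply: measurable_fun_ifT => //.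
exact: (measurableT_comp (f := fun n : nat => (i < n)%N)).
Qed.

HB.instance Definition _ d (T : measurableType d) (R : realType)
    (P : probability T R) (D : nat) (xi : 'I_D -> {RV P >-> R})
    (eta : {RV P >-> nat}) :=
  isMeasurableFun.Build _ _ _ _ (random_sum xi eta)
    (measurable_random_sum xi eta).

(* Main.v *)
(* A tail that is bounded away from 0 on every half-line (-oo, M] and satisfies
   the O_exponential condition at infinity satisfies, for every a, a shift
   inequality P(X > x) <= C P(X > x + a) with C uniform in x over the whole
   line.  Such an inequality survives the addition of any independent variable,
   whatever its tail: condition on that variable and apply the inequality at
   the shifted point.  So the part of the random sum with eta >= kappa satisfies
   it.  The part with eta < kappa is dominated by S_kappa, hence, by
   independence, by the former part up to the factor 1/P(eta = kappa).

   Conditioning is discretized: fixing eta and the integer parts of the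
   variables other than xi_kappa determines S_eta - xi_kappa up to an error D,
   which the arbitrary shift absorbs, so that only countable additivity and the
   product rule are needed. *)

Require Import Defs.
From HB Require Import structures.
From mathcomp Require Import all_boot all_order all_algebra.
From mathcomp Require Import all_classical all_reals all_analysis.
From mathcomp Require Import ring lra.

Set Implicit Arguments.
Unset Strict Implicit.

Import Order.TTheory GRing.Theory Num.Theory.
Import numFieldNormedType.Exports.

Local Open Scope classical_set_scope.
Local Open Scope ring_scope.

(** * Shift inequalities on the whole line in place of limits of quotients *)

Lemma limf_einf_le_esup (R : realType) (X : choiceType) (T : filteredType X)
    (f : T -> \bar R) (F : set_system T) (FF : ProperFilter F) :
  (limf_einf f F <= limf_esup f F)%E.
Proof.
rewrite limf_einfE limf_esupE.
apply: ge_ereal_sup => _ [U FU <-]; apply: le_ereal_inf_tmp => _ [V FV <-].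
have [x [Ux Vx]] := filter_ex (filterI FU FV).
apply: (@le_trans _ _ (f x)).
  by apply: ereal_inf_lbound; exists x.
by apply: ereal_sup_ubound; exists x.
Qed.

(** The liminf controls only large [x]; on a left half-line a constant exists because the tail is at
    most 1 and is bounded below there by its positive value at a fixed point. Conversely, the shift
    by [a] bounds the quotient from below and the shift by [- a] bounds it from above. *)
Lemma O_exponentialP (R : realType) (F : R -> R) :
  {homo F : x y / x <= y} -> (forall x, 0 <= F x) ->
  O_exponential F <->
  (forall x, 0 < tail F x) /\
  forall a, exists2 C, 0 <= C & forall x, tail F x <= C * tail F (x + a).
Proof.
move=> Fmono F0; split=> -[tail0 H]; split=> // a.
  have tailm x y : x <= y -> tail F y <= tail F x.
    by move=> xy; rewrite lerD2l lerN2; exact: Fmono.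
  have [/= + _ _] := H a; rewrite limf_einfE => /ereal_sup_gt[_ [V FV <-]].
  move=> e0; case: FV => M [_ MV].
  have qe x : M < x -> (ereal_inf [set (tail F (x + a) / tail F x)%:E | x in V]
      <= (tail F (x + a) / tail F x)%:E)%E.
    by move=> Mx; apply: ereal_inf_lbound; exists x => //; exact: MV.
  (* The infimum cannot be [+oo], since the quotient at [M + 1] is finite. *)
  move: e0 qe; case: ereal_inf => [e| |]//; last first.
    by move=> _ /(_ (M + 1)); rewrite ltrDl => /(_ ltr01).
  rewrite lte_fin => e0 qe.
  (* The first summand serves [M < x], the second [x <= M]. *)
  exists (e^-1 + (tail F (M + 1 + a))^-1).
    by rewrite addr_ge0// invr_ge0 ltW.
  move=> x; have [Mx|xM] := ltP M x.
    have := qe _ Mx; rewrite lee_fin ler_pdivlMr// => h.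
    apply: (@le_trans _ _ (e^-1 * tail F (x + a))).
      by rewrite ler_pdivlMl.
    by rewrite ler_wpM2r ?ltW// ltrDl invr_gt0.
  apply: (@le_trans _ _ 1); first by rewrite /tail gerDl oppr_le0.
  apply: (@le_trans _ _ ((tail F (M + 1 + a))^-1 * tail F (x + a))).
    rewrite ler_pdivlMl// mulr1; apply: tailm.
    by rewrite lerD2r (le_trans xM)// lerDl.
  by rewrite ler_wpM2r ?ltW// ltrDr invr_gt0.
have [C C0 HC] := H a; have [C' C'0 HC'] := H (- a).
split.
- rewrite limf_einfE.
  (* [C] is only known to be nonnegative, so [C + 1] is inverted instead. *)
  apply: (@lt_le_trans _ _ ((C + 1)^-1)%:E).
    by rewrite lte_fin invr_gt0 ltr_wpDl.
  apply: (@le_trans _ _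
      (ereal_inf (range (fun x => (tail F (x + a) / tail F x)%:E)))).
    apply: le_ereal_inf_tmp => _ [x _ <-].
    rewrite lee_fin ler_pdivlMr// ler_pdivrMl ?ltr_wpDl//.
    by rewrite (le_trans (HC x))// ler_wpM2r ?lerDl// ltW.
  by apply: ereal_sup_ubound; exists setT => //; exact: filterT.
- exact: limf_einf_le_esup.
- rewrite limf_esupE.
  apply: (@le_lt_trans _ _ C'%:E); last exact: ltry.
  apply: (@le_trans _ _
      (ereal_sup (range (fun x => (tail F (x + a) / tail F x)%:E)))).
    by apply: ereal_inf_lbound; exists setT => //; exact: filterT.
  apply: ge_ereal_sup => _ [x _ <-].
  by rewrite lee_fin ler_pdivrMr// (le_trans (HC' _))// addrK.
Qed.

(** * Tails as probabilities, and summation over countable partitions *)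

Lemma tail_distr_fun d (T : measurableType d) (R : realType)
    (P : probability T R) (X : {RV P >-> R}) (x : R) :
  (tail (distr_fun X) x)%:E = P [set w | x < X w].
Proof.
rewrite /tail /distr_fun EFinB fineK ?fin_num_measure// -ccdf_1_cdf.
rewrite /ccdf /distribution /pushforward /=; congr (P _).
by apply/seteqP; split=> w /=; rewrite in_itv/= andbT.
Qed.

Lemma measurable_gt_RV d (T : measurableType d) (R : realType)
    (P : probability T R) (X : {RV P >-> R}) (x : R) :
  measurable [set w | x < X w].
Proof.
rewrite (_ : [set _ | _] = X @^-1` `]x, +oo[).
  by rewrite -[_ @^-1` _]setTI; exact: measurable_funP.
by apply/seteqP; split=> w /=; rewrite in_itv/= andbT.
Qed.

(** A discrete substitute for conditioning on [g]: its fibers cut the space into countably many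
    pieces, over which the inequality is summed. *)
Lemma le_measure_fibers d (T : measurableType d) (R : realType)
    (mu : {measure set T -> \bar R}) (I : countType) (g : T -> I)
    (A B : set T) (C : R) :
  0 <= C -> measurable A -> measurable B ->
  (forall i, measurable (g @^-1` [set i])) ->
  (forall i, mu (A `&` g @^-1` [set i]) <= C%:E * mu (B `&` g @^-1` [set i]))%E ->
  (mu A <= C%:E * mu B)%E.
Proof.
move=> C0 mA mB mg H.
(* The fibers are reindexed by natural numbers; a number that encodes no element of [I] gives the
   empty set. *)
pose F n := (pickle \o g) @^-1` [set n].
have FE n : F n = oapp (fun i => g @^-1` [set i]) set0 (pickle_inv n).
  apply/seteqP; split=> w /=; rewrite /F/=.
    by move=> <-; rewrite pickleK_inv.
  by have := @pickle_invK I n; case: (pickle_inv n) => //= i <- ->.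
have mF n : measurable (F n) by rewrite FE; case: (pickle_inv n) => /=.
have sumF S : measurable S -> mu S = (\sum_(0 <= n <oo) mu (S `&` F n))%E.
  move=> mS; rewrite -measure_semi_bigcup.
  - rewrite -setI_bigcupr; congr (mu _); apply/seteqP; split=> [w Sw|w []//].
    by split=> //; exists (pickle (g w)).
  - by move=> n; exact: measurableI.
  - by apply: trivIset_setIl; exact: trivIset_preimage1.
  - by apply: bigcup_measurable => n _; exact: measurableI.
rewrite (sumF A mA) (sumF B mB) -nneseriesZl//.
apply: lee_nneseries => // n _; rewrite FE; case: (pickle_inv n) => //=.
by rewrite !setI0 !measure0 mule0.
Qed.

Lemma O_exponential_distr_funP d (T : measurableType d) (R : realType)
    (P : probability T R) (X : {RV P >-> R}) :
  O_exponential (distr_fun X) <->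
  (forall x, 0 < P [set w | (x < X w)%R])%E /\
  forall a, exists2 C, 0 <= C &
    forall x, (P [set w | (x < X w)%R] <= C%:E * P [set w | (x + a < X w)%R])%E.
Proof.
have F0 x : 0 <= distr_fun X x by exact: fine_ge0.
have Fm : {homo distr_fun X : x y / x <= y}.
  by move=> x y xy; rewrite fine_le ?fin_num_measure//; exact: cdf_nondecreasing.
have tE := tail_distr_fun X.
split=> [/(O_exponentialP Fm F0)[t0 H]|[t0 H]]; last apply/(O_exponentialP Fm F0).
  split=> [x|a]; first by rewrite -tE lte_fin.
  by have [C C0 HC] := H a; exists C => // x; rewrite -!tE lee_fin.
split=> [x|a]; first by rewrite -lte_fin tE.
by have [C C0 HC] := H a; exists C => // x; rewrite -lee_fin EFinM !tE.
Qed.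

(** * Independence of one variable from [eta] and the other variables *)

Lemma measurable_g_sigma_preimage (T : pointedType) (R : realType) (n : nat)
    (X : 'I_n -> T -> R) (i : 'I_n) :
  measurable_fun setT
    (X i : g_sigma_algebraType
      (\big[setU/set0]_(i < n) preimage_set_system setT (X i) measurable) -> R).
Proof.
move=> _ A mA; apply: sub_sigma_algebra.
by rewrite (bigD1 i)//=; left; exists A.
Qed.

(** The factor of [eta] splits off on both sides, because the remaining events lie in the
    sigma-algebra generated by the family. Mutual independence is then used twice: over all indices
    and over all but [kappa]. *)
Lemma probability_one_rest d (T : measurableType d) (R : realType)
    (P : probability T R) (D : nat) (xi : 'I_D -> {RV P >-> R})
    (eta : {RV P >-> nat}) (kappa : 'I_D)
    (A : 'I_D -> set R) (B : set R) (M : set nat) :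
  mutually_independent xi -> independent_of_family eta xi ->
  (forall i, measurable (A i)) -> measurable B ->
  let E := eta @^-1` M `&`
    \bigcap_(i in [set` [set~ kappa]%SET]) xi i @^-1` A i in
  P (xi kappa @^-1` B `&` E) = (P (xi kappa @^-1` B) * P E)%E.
Proof.
move=> xi_indep eta_indep mA mB E.
pose J := [set~ kappa]%SET.
(* With [B] in slot [kappa], the joint event becomes one intersection over all indices. *)
pose A' i := if i == kappa then B else A i.
have mA' i : measurable (A' i) by rewrite /A'; case: ifP.
pose W := \big[setU/set0]_(i < D)
  preimage_set_system setT (xi i : T -> R) measurable.
have mxi i S : measurable S -> (<<s W >>) (xi i @^-1` S).
  move=> mS; rewrite -[_ @^-1` _]setTI.
  exact: (@measurable_g_sigma_preimage _ _ _ (fun i => xi i : T -> R)).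
have sA : (<<s W >>) (\bigcap_(i in [set` J]) xi i @^-1` A i).
  apply: (@fin_bigcap_measurable _ (g_sigma_algebraType W)) => // i _.
  exact: mxi.
have EA : \bigcap_(i in [set` [set: 'I_D]%SET]) xi i @^-1` A' i =
    xi kappa @^-1` B `&` \bigcap_(i in [set` J]) xi i @^-1` A i.
  apply/seteqP; split=> w /=.
    move=> H; split; first by have := H kappa; rewrite /A' eqxx/= inE; exact.
    move=> i /=; rewrite !inE => ik.
    by have := H i; rewrite /A' (negbTE ik) /= inE; exact.
  move=> [HB H] i _; rewrite /A' /=; case: eqP => [->//|/eqP ik].
  by apply: H => /=; rewrite !inE.
have sB : (<<s W >>)
    (xi kappa @^-1` B `&` \bigcap_(i in [set` J]) xi i @^-1` A i).
  exact: (@measurableI _ (g_sigma_algebraType W) _ _ (mxi _ _ mB) sA).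
rewrite /E setICA !eta_indep// muleCA; congr (_ * _)%E.
rewrite -EA !xi_indep// (bigD1 kappa)/= ?inE// {1}/A' eqxx; congr (_ * _)%E.
apply: eq_big => [i|i]; rewrite !inE// => ik.
by rewrite /A' (negbTE ik).
Qed.

(** * The shift inequality for the random sum *)

Lemma measurable_sum_cond d (T : measurableType d) (R : realType)
    (I : finType) (Q : pred I) (f : I -> T -> R) :
  (forall i, measurable_fun setT (f i)) ->
  measurable_fun setT (fun w => \sum_(i | Q i) f i w).
Proof.
move=> mf; under eq_fun do rewrite big_mkcond.
by apply: measurable_sum => i; case: (Q i); [exact: mf|exact: measurable_cst].
Qed.

Lemma floor_fiber_measurable (R : realType) (k : int) :
  measurable [set y : R | Num.floor y = k].
Proof.
rewrite (_ : [set _ | _] = `[k%:~R, (k + 1)%:~R[%classic)//.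
by apply/seteqP; split=> y /=; rewrite in_itv/= -floor_eq => /eqP.
Qed.

Lemma random_sum_shift d (T : measurableType d) (R : realType)
    (P : probability T R) (D : nat) (xi : 'I_D -> {RV P >-> R})
    (eta : {RV P >-> nat}) (kappa : 'I_D) (a C : R) :
  mutually_independent xi -> independent_of_family eta xi ->
  0 <= C ->
  (forall x, (P [set w | (x < xi kappa w)%R]
    <= C%:E * P [set w | (x + (D%:R + a) < xi kappa w)%R])%E) ->
  forall x,
  (P [set w | (x < random_sum xi eta w)%R /\ (kappa < eta w)%N] <=
   C%:E * P [set w | (x + a < random_sum xi eta w)%R /\ (kappa < eta w)%N])%E.
Proof.
move=> xi_indep eta_indep C0 HC x.
(* The dummy value 0 in slot [kappa] keeps all information on [xi kappa] out of the fibers, so that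
   [probability_one_rest] applies to them. *)
pose g w : nat * {ffun 'I_D -> int} :=
  (eta w, [ffun i => if i == kappa then 0 else Num.floor (xi i w)]).
have meta (M : set nat) : measurable (eta @^-1` M).
  by rewrite -[_ @^-1` _]setTI; exact: measurable_funP.
have mS y : measurable [set w | (y < random_sum xi eta w)%R /\ (kappa < eta w)%N].
  apply: measurableI; first exact: (measurable_gt_RV (P := P) (random_sum xi eta)).
  exact: (meta [set n | (kappa < n)%N]).
pose A (k : {ffun 'I_D -> int}) i := [set y : R | Num.floor y = k i].
have mA k i : measurable (A k i) by exact: floor_fiber_measurable.
have gE m (k : {ffun 'I_D -> int}) : k kappa = 0 -> g @^-1` [set (m, k)] =
    eta @^-1` [set m] `&` \bigcap_(i in [set` [set~ kappa]%SET]) xi i @^-1` A k i.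
  move=> k0; apply/seteqP; split=> w /=.
    move=> -[-> <-]; split=> // i /=; rewrite !inE => /negbTE ik.
    by rewrite /A/= ffunE ik.
  move=> [em H]; rewrite /g em; congr pair; apply/ffunP => i; rewrite ffunE.
  by case: eqP => [->//|/eqP ik]; apply: H => /=; rewrite !inE.
have g0 m (k : {ffun 'I_D -> int}) : k kappa != 0 -> g @^-1` [set (m, k)] = set0.
  move=> k0; apply/seteqP; split=> w //= -[_ kE].
  by move: k0; rewrite -kE ffunE eqxx eqxx.
have mg mk : measurable (g @^-1` [set mk]).
  case: mk => m k; have [k0|k0] := eqVneq (k kappa) 0; last by rewrite g0.
  rewrite gE//; apply: measurableI; first exact: meta.
  apply: fin_bigcap_measurable => // i _.
  by rewrite -[_ @^-1` _]setTI; exact: measurable_funP.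
apply: (le_measure_fibers (g := g)) => // -[m k].
have [k0|k0] := eqVneq (k kappa) 0; last first.
  by rewrite g0// !setI0 measure0 mule0.
have [mk|km] := leqP m kappa.
  rewrite (_ : _ `&` _ = set0) ?measure0 ?mule_ge0//.
  by apply/seteqP; split=> w //= [[_ ke] [em _]]; rewrite em ltnNge mk in ke.
(* Since [kappa < m], the variable [xi kappa] is a summand on this fiber; [s] collects the integer
   parts of the other summands, each of which loses less than 1 by rounding. *)
pose s : R := \sum_(i < D | (i < m)%N && (i != kappa)) (k i)%:~R.
have indep y : (P ([set w | (y < xi kappa w)%R] `&` g @^-1` [set (m, k)]) =
    P [set w | (y < xi kappa w)%R] * P (g @^-1` [set (m, k)]))%E.
  rewrite gE// (_ : [set w | _] = xi kappa @^-1` `]y, +oo[).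
    exact: probability_one_rest.
  by apply/seteqP; split=> w /=; rewrite in_itv/= andbT.
have sum_bounds w : g w = (m, k) ->
    xi kappa w + s <= random_sum xi eta w <= xi kappa w + s + D%:R.
  move=> [em kE].
  have ks i : i != kappa -> k i = Num.floor (xi i w).
    by move=> /negbTE ik; rewrite -kE ffunE ik.
  rewrite /random_sum /partial_sum em (bigD1 kappa)//= -addrA !lerD2l.
  apply/andP; split.
    by apply: ler_sum => i /andP[_ /ks ->]; exact: floor_le.
  apply: (@le_trans _ _
      (\sum_(i < D | (i < m)%N && (i != kappa)) ((k i)%:~R + 1))).
    apply: ler_sum => i /andP[_ /ks ->]; have /andP[_ /ltW] := floor_itv (xi i w).
    by rewrite intrD.
  rewrite big_split/= lerD2l sumr_const ler_nat.
  by rewrite (leq_trans (max_card _))// card_ord.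
(* The rounding error lies between 0 and [D]: the threshold is first lowered by [D], and the shift
   by [D + a] then leads to [x - s + a], where the lower bound of [sum_bounds] suffices. *)
apply: (@le_trans _ _
    (P ([set w | x - s - D%:R < xi kappa w]%R `&` g @^-1` [set (m, k)]))).
  apply: le_measure; rewrite ?inE.
  - exact: measurableI.
  - by apply: measurableI => //; exact: measurable_gt_RV.
  move=> w [[/= xS _] gw]; split=> //=.
  by have /andP[_] := sum_bounds _ gw; lra.
apply: (@le_trans _ _ (C%:E *
    P ([set w | x - s + a < xi kappa w]%R `&` g @^-1` [set (m, k)]))%E).
  rewrite !indep muleA; apply: lee_wpmul2r => //.
  by apply: le_trans (HC _) _; rewrite (_ : _ + _ = x - s + a)%R//; ring.
apply: lee_wpmul2l; first by rewrite lee_fin.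
apply: le_measure; rewrite ?inE.
- by apply: measurableI => //; exact: measurable_gt_RV.
- exact: measurableI.
move=> w [/= xS gw]; split=> //=; split; last by case: gw => ->.
by have /andP[+ _] := sum_bounds _ gw; lra.
Qed.

Lemma measurable_partial_sum_gt d (T : measurableType d) (R : realType)
    (P : probability T R) (D : nat) (xi : 'I_D -> {RV P >-> R}) (n : nat) (x : R) :
  measurable [set w | x < partial_sum xi n w].
Proof.
rewrite (_ : [set _ | _] = partial_sum xi n @^-1` `]x, +oo[).
  rewrite -[_ @^-1` _]setTI.
  by apply: measurable_sum_cond => // i; exact: measurable_funP.
by apply/seteqP; split=> w /=; rewrite in_itv/= andbT.
Qed.

(** On the event [eta = n] the random sum is the partial sum, and that event is independent of the
    partial sum; the constant is the inverse of its positive probability. *)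
Lemma partial_sum_tail_le_random_sum d (T : measurableType d) (R : realType)
    (P : probability T R) (D : nat) (xi : 'I_D -> {RV P >-> R})
    (eta : {RV P >-> nat}) (n : nat) :
  (forall k w, 0 <= xi k w) -> independent_of_family eta xi ->
  supp eta n ->
  exists2 C, 0 <= C & forall x,
    (P [set w | (x < partial_sum xi n w)%R] <=
     C%:E * P [set w | (x < random_sum xi eta w)%R /\ (n <= eta w)%N])%E.
Proof.
move=> xi0 eta_indep pn.
have meta (M : set nat) : measurable (eta @^-1` M).
  by rewrite -[_ @^-1` _]setTI; exact: measurable_funP.
have fp : P (eta @^-1` [set n]) \is a fin_num by rewrite fin_num_measure.
have p0 : 0 < fine (P (eta @^-1` [set n])) by rewrite -lte_fin fineK.
exists (fine (P (eta @^-1` [set n])))^-1; first by rewrite invr_ge0 ltW.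
move=> x.
rewrite -[leLHS]mul1e -(@mulVf _ (fine (P (eta @^-1` [set n])))) ?gt_eqF//.
rewrite EFinM -muleA; apply: lee_wpmul2l; first by rewrite lee_fin invr_ge0 ltW.
pose W := \big[setU/set0]_(i < D)
  preimage_set_system setT (xi i : T -> R) measurable.
(* Plain measurability is not enough here: [eta_indep] asks for an event of the sigma-algebra
   generated by the [xi i]. *)
have sS : (<<s W >>) [set w | x < partial_sum xi n w].
  rewrite (_ : [set _ | _] = partial_sum xi n @^-1` `]x, +oo[).
    rewrite -[_ @^-1` _]setTI.
    apply: (@measurable_sum_cond _ (g_sigma_algebraType W)) => // i.
    exact: (@measurable_g_sigma_preimage _ _ _ (fun i => xi i : T -> R)).
  by apply/seteqP; split=> w /=; rewrite in_itv/= andbT.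
rewrite fineK// -eta_indep//; apply: le_measure; rewrite ?inE.
- apply: measurableI => //.
  exact: measurable_partial_sum_gt.
- apply: measurableI; first exact: (measurable_gt_RV (P := P) (random_sum xi eta)).
  exact: (meta [set m | (n <= m)%N]).
by move=> w /= [en xS]; rewrite /random_sum en.
Qed.

Theorem theorem5 (d : measure_display) (T : measurableType d) (R : realType)
    (P : probability T R) (D : nat) (D_gt0 : (0 < D)%N)
    (xi : 'I_D -> {RV P >-> R}) (eta : {RV P >-> nat})
    (xi_ge0 : forall (k : 'I_D) (w : T), 0 <= xi k w)
    (xi_indep : mutually_independent xi)
    (eta_counting : counting_rv eta)
    (eta_indep : independent_of_family eta xi)
    (eta_le : P [set w | (eta w <= D)%N] = 1%E)
    (kappa : 'I_D)
    (kappa_supp : (supp eta `\ 0%N) kappa.+1)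
    (kappa_OL : O_exponential (distr_fun (xi kappa)))
    (xi_tails : forall k : 'I_D,
      (tail (distr_fun (xi k)) x / tail (distr_fun (xi kappa)) x
         @[x --> +oo] --> (0 : R))
      \/ O_exponential (distr_fun (xi k))) :
  O_exponential (distr_fun (P := P) (random_sum xi eta)).
Proof.
have /O_exponential_distr_funP[kappa0 HC] := kappa_OL.
have [supp_kappa _] := kappa_supp.
have [K K0 HK] := partial_sum_tail_le_random_sum xi_ge0 eta_indep supp_kappa.
have mS y : measurable [set w | y < random_sum xi eta w].
  exact: (measurable_gt_RV (P := P) (random_sum xi eta)).
have meta (M : set nat) : measurable (eta @^-1` M).
  by rewrite -[_ @^-1` _]setTI; exact: measurable_funP.
have mSk y : measurable [set w | y < random_sum xi eta w /\ (kappa < eta w)%N].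
  exact: (measurableI _ _ (mS y) (meta [set n | (kappa < n)%N])).
have mpart y : measurable [set w | y < partial_sum xi kappa.+1 w].
  exact: measurable_partial_sum_gt.
apply/O_exponential_distr_funP; split=> [x|a].
  (* By nonnegativity [xi kappa] is at most the partial sum containing it, so its positive tail
     bounds this product from below. *)
  have : (0 < K%:E * P [set w | (x < random_sum xi eta w)%R])%E.
    apply: lt_le_trans (kappa0 x) _.
    apply: (@le_trans _ _ (P [set w | (x < partial_sum xi kappa.+1 w)%R])).
      apply: le_measure; rewrite ?inE//; first exact: measurable_gt_RV.
      move=> w /= xX; apply: lt_le_trans xX _.
      rewrite /partial_sum (bigD1 kappa)//= lerDl.
      by apply: sumr_ge0 => i _; exact: xi_ge0.
    apply: le_trans (HK x) _; apply: lee_wpmul2l; first by rewrite lee_fin.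
    by apply: le_measure; rewrite ?inE// => w [].
  by rewrite lt0e mule_eq0 negb_or => /andP[/andP[_ P0] _]; rewrite lt0e P0/=.
(* The extra [D] pays for the rounding in [random_sum_shift]. *)
have [C C0 HCa] := HC (D%:R + a).
(* [K] accounts for the part with [eta <= kappa], and 1 for the part with [kappa < eta]. *)
exists ((K + 1) * C); first by rewrite mulr_ge0// addr_ge0.
move=> x.
have shift := @random_sum_shift _ _ _ _ _ _ _ _ _ _ xi_indep eta_indep C0 HCa x.
apply: (@le_trans _ _ ((K + 1)%:E *
    P [set w | (x < random_sum xi eta w)%R /\ (kappa < eta w)%N])%E); last first.
  rewrite EFinM -muleA; apply: lee_wpmul2l; first by rewrite lee_fin addr_ge0.
  apply: le_trans shift _; apply: lee_wpmul2l; first by rewrite lee_fin.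
  by apply: le_measure; rewrite ?inE// => w [].
rewrite EFinD ge0_muleDl ?lee_fin// mul1e.
apply: le_trans (leeD (HK x) (lexx _)).
apply: le_trans (measureU2 _ (mpart x) (mSk x)); apply: le_measure; rewrite ?inE//.
  exact: measurableU.
(* If [eta w <= kappa], the partial sum up to [kappa.+1] has all summands of the random sum, and its
   further ones are nonnegative. *)
move=> w /= xS; have [ek|ke] := leqP (eta w) kappa; [left|by right].
apply: lt_le_trans xS _; rewrite /random_sum /partial_sum.
rewrite big_mkcond [leRHS]big_mkcond; apply: ler_sum => i _.
case: ifP => [ie|_]; last by case: ifP.
by rewrite ltnS (leq_trans (ltnW ie) ek).
Qed.
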